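(* A Cayley permutation $\pi$ is tortoise pop-stack sortable if and only if $\pi$ avoids $231$, $312$, $221$ and $211$.
   Context: A Cayley permutation is a finite word $\pi=\pi_1\cdots\pi_n$ over the positive integers such that every integer from $1$ to $\max(\pi)$ occurs at least once. A word contains a pattern $p=p_1\cdots p_k$ if it has a subsequence $x_{i_1}\cdots x_{i_k}$ with $x_{i_u}<x_{i_v}$ iff $p_u<p_v$ and $x_{i_u}=x_{i_v}$ iff $p_u=p_v$; otherwise it avoids $p$. A tortoise pop-stack processes an input from left to right with a right-greedy algorithm: while the input is nonempty, the next input element is pushed if the resulting stack contents, read from top to bottom, avoid both patterns $21$ and $11$ (i.e. are strictly increasing from top to bottom); otherwise a pop operation is performed, which removes all elements of the stack, appending them to the output in order from top to bottom. When the input is exhausted, the stack is emptied in the same way. $\pi$ is tortoise pop-stack sortable if the output on input $\pi$ is weakly increasing. *)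

(* Defs.v *)
From mathcomp Require Import all_boot.

Set Implicit Arguments.
Unset Strict Implicit.
Unset Printing Implicit Defensive.

(* The empty word (n = 0) is a Cayley permutation. *)
Definition cayley (w : seq nat) : bool :=
  all (fun x => 0 < x) w &&
  all (fun k => k \in w) (iota 1 (\max_(x <- w) x)).

Definition order_iso (t p : seq nat) : bool :=
  (size t == size p) &&
  [forall u : 'I_(size p), forall v : 'I_(size p),
     ((nth 0 t u < nth 0 t v) == (nth 0 p u < nth 0 p v)) &&
     ((nth 0 t u == nth 0 t v) == (nth 0 p u == nth 0 p v))].

(* The subsequences of w are the words mask m w for m a bit vector of length
   size w; quantifying over these makes containment a boolean, so that the
   sorting machine below can branch on it. *)
Definition contains (w p : seq nat) : bool :=
  [exists m : (size w).-tuple bool, order_iso (mask m w) p].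

Definition avoids (w p : seq nat) : bool := ~~ contains w p.

Lemma containsP (w p : seq nat) :
  reflect (exists2 t, subseq t w & order_iso t p) (contains w p).
Proof.
apply: (iffP existsP) => [[m iso]|[_ /subseqP[m szm ->] iso]].
  by exists (mask m w); first exact: mask_subseq.
by exists (tcast szm (in_tuple m)); rewrite val_tcast.
Qed.

(* A stack is listed from top to bottom. *)
Definition tortoise_stack (st : seq nat) : bool :=
  avoids st [:: 2; 1] && avoids st [:: 1; 1].

(* Run of the machine from stack contents st and output so far out. A pop
   empties the whole stack, and a one-element stack contains neither pattern,
   so an element whose push is refused is pushed right after the pop. *)
Fixpoint tortoise_run (st out input : seq nat) : seq nat :=
  if input is x :: input' then
    if tortoise_stack (x :: st) then tortoise_run (x :: st) out input'
    else tortoise_run [:: x] (out ++ st) input'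
  else out ++ st.

Definition tortoise_output (w : seq nat) : seq nat := tortoise_run [::] [::] w.

Definition tortoise_sortable (w : seq nat) : bool :=
  sorted leq (tortoise_output w).

(* Main.v *)
(* The stack is always strictly increasing from top to bottom, so the machine
   cuts the input into its maximal strictly decreasing runs and reverses each.
   The output is sorted iff no entry of a run exceeds an entry of a later run.
   Two entries in weakly ascending order lie in distinct runs; hence both a
   triple [a b c] with [c < a <= b] (231, 221) and one with [b <= c < a] (312,
   211) give such a pair [a > c].  Conversely, if [s > y] lie in distinct runs,
   let [h <= x] be the entries on either side of the break that ends the run of
   [s]: if [x < s] then [s h x] is of the second kind, else [s x y] is of the
   first. *)
Require Import Defs.
From mathcomp Require Import all_boot zify.

(** Quantifiers over ordinals do not reduce; over [iota], a concrete pattern unfolds by [/=] into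
    comparisons that [lia] decides. *)
Lemma order_isoE (t p : seq nat) :
  order_iso t p = (size t == size p) &&
    all (fun u => all (fun v =>
     ((nth 0 t u < nth 0 t v) == (nth 0 p u < nth 0 p v)) &&
     ((nth 0 t u == nth 0 t v) == (nth 0 p u == nth 0 p v)))
      (iota 0 (size p))) (iota 0 (size p)).
Proof.
rewrite /order_iso; congr (_ && _).
apply/forallP/allP => [iso u | iso u].
  rewrite mem_iota /= => ltu; apply/allP => v; rewrite mem_iota /= => ltv.
  by have /forallP/(_ (Ordinal ltv)) := iso (Ordinal ltu).
apply/forallP => v; have lt_iota (i : 'I_(size p)) : (i : nat) \in iota 0 (size p).
  by rewrite mem_iota /=.
by have /allP/(_ v (lt_iota v)) := iso u (lt_iota u).
Qed.

Lemma pairwise_subseq2P (T : eqType) (r : rel T) (s : seq T) :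
  reflect (forall a b, subseq [:: a; b] s -> r a b) (pairwise r s).
Proof.
apply: (iffP idP) => [rs a b sub|].
  by have := subseq_pairwise sub rs; rewrite /= !andbT.
elim: s => //= x s IHs rs; apply/andP; split.
  by apply/allP => b sb; apply: rs; rewrite eqxx sub1seq.
apply: IHs => a b sub; apply: rs; case: eqP => // _.
by move: sub; rewrite !sub1seq => /mem_subseq; apply; rewrite !inE eqxx orbT.
Qed.

Lemma tortoise_stackE (st : seq nat) : tortoise_stack st = sorted ltn st.
Proof.
rewrite sorted_pairwise; last exact: ltn_trans.
apply/andP/pairwise_subseq2P => [[/containsP av21 /containsP av11] a b sub | lts].
  rewrite /= ltnNge leq_eqVlt; apply/norP; split; apply/negP => ab.
    by apply: av11; exists [:: a; b]; rewrite // order_isoE /=; lia.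
  by apply: av21; exists [:: a; b]; rewrite // order_isoE /=; lia.
by split; apply/containsP => -[[|a [|b [|c t]]] // /lts /= ltab];
  rewrite order_isoE /=; lia.
Qed.

Lemma subseq_catP {T : eqType} {s s1 s2 : seq T} :
  subseq s (s1 ++ s2) ->
  exists t1 t2, [/\ s = t1 ++ t2, subseq t1 s1 & subseq t2 s2].
Proof.
case/subseqP=> m szm ->.
exists (mask (take (size s1) m) s1), (mask (drop (size s1) m) s2).
rewrite !mask_subseq -mask_cat ?cat_take_drop //.
by rewrite size_takel // szm size_cat leq_addr.
Qed.

Definition has_obstruction (w : seq nat) : Prop :=
  exists a b c, subseq [:: a; b; c] w /\ ((c < a <= b) || (b <= c < a)).

Lemma avoids_obstruction (w : seq nat) :
  [/\ avoids w [:: 2; 3; 1], avoids w [:: 3; 1; 2],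
      avoids w [:: 2; 2; 1] & avoids w [:: 2; 1; 1]] <-> ~ has_obstruction w.
Proof.
split=> [[/containsP n231 /containsP n312 /containsP n221 /containsP n211]|nobs].
  case=> a [b [c [sub /orP[/andP[ca]|/andP[+ ca]]]]];
    rewrite leq_eqVlt => /orP[eqv|lt].
  - by apply: n221; exists [:: a; b; c]; rewrite // order_isoE /=; lia.
  - by apply: n231; exists [:: a; b; c]; rewrite // order_isoE /=; lia.
  - by apply: n211; exists [:: a; b; c]; rewrite // order_isoE /=; lia.
  - by apply: n312; exists [:: a; b; c]; rewrite // order_isoE /=; lia.
split; apply/containsP => -[t sub]; rewrite order_isoE;
  move: t sub => [|a [|b [|c [|? ?]]]] //= sub iso;
  by apply: nobs; exists a, b, c; split=> //; lia.
Qed.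

Lemma tortoise_run_cat (st out input : seq nat) :
  tortoise_run st out input = out ++ tortoise_run st [::] input.
Proof.
elim: input st out => //= x input IH st out; case: ifP => _ //.
by rewrite IH [in RHS]IH catA.
Qed.

Lemma perm_tortoise_run (st input : seq nat) :
  perm_eq (tortoise_run st [::] input) (st ++ input).
Proof.
elim: input st => [|x input IH] st /=; first by rewrite cats0.
case: ifP => _; last by rewrite tortoise_run_cat perm_cat2l IH.
by apply: perm_trans (IH _) _; rewrite perm_sym perm_catC /= perm_cons perm_catC.
Qed.

(** Either kind of obstruction contains a weak ascent, [a <= b] or [b <= c]. *)
Lemma decreasing_no_obstruction {st : seq nat} :
  sorted ltn st -> ~ has_obstruction (rev st).
Proof.
rewrite -(revK st) rev_sorted revK sorted_pairwise; last first.
  by move=> y x z /= yx zy; exact: ltn_trans zy yx.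
move=> dec [a [b [c [sub]]]].
by have := subseq_pairwise sub dec; rewrite /=; lia.
Qed.

(** This describes a pop: [rev (h :: st)] is the finished run in input order, and [h <= x] is the
    break that ends it. The right-hand side has the shape of sortedness of a concatenation, ready
    for induction on the input. *)
Lemma obstruction_at_break (h x : nat) (st input : seq nat) :
  sorted ltn (h :: st) -> h <= x ->
  (~ has_obstruction (rev (h :: st) ++ x :: input)) <->
  (allrel leq (h :: st) (x :: input) /\ ~ has_obstruction (x :: input)).
Proof.
move=> srt lehx; split=> [nobs|[/allrelP le_st nobs] [a [b [c [sub obs]]]]].
  split; last first.
    case=> a [b [c [sub obs]]]; apply: nobs; exists a, b, c; split=> //.
    exact: subseq_trans sub (suffix_subseq _ _).
  have le_stx s : s \in h :: st -> s <= x.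
    rewrite inE => /predU1P[-> // | sst]; rewrite leqNgt; apply/negP => ltxs.
    apply: nobs; exists s, h, x; split; last by rewrite lehx ltxs orbT.
    rewrite rev_cons -cats1 -catA.
    rewrite -[[:: s; h; x]]/([:: s] ++ [:: h] ++ [:: x]) !cat_subseq //.
      by rewrite sub1seq mem_rev.
    by rewrite sub1seq inE eqxx.
  apply/allrelP => s y sst; rewrite inE => /predU1P[->|yin]; first exact: le_stx.
  rewrite leqNgt; apply/negP => ltys; apply: nobs; exists s, x, y.
  rewrite ltys le_stx //; split=> //.
  rewrite -[[:: s; x; y]]/([:: s] ++ [:: x; y]) cat_subseq //.
    by rewrite sub1seq mem_rev.
  by rewrite /= eqxx sub1seq.
(* Cut the obstruction at the break. It cannot lie wholly on one side; otherwise [a] is in the run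
   and [c] after it, so [a <= c], whereas both kinds have [c < a]. *)
have [t1 [t2 [Et sub1 sub2]]] := subseq_catP sub.
case: t1 => [|a' t1] in Et sub1; first by case: nobs; exists a, b, c; rewrite Et.
have ain : a \in h :: st.
  by rewrite -mem_rev (mem_subseq sub1) //; case: Et => ->; rewrite inE eqxx.
case/lastP: t2 => [|t2 c'] in Et sub2.
  apply: (decreasing_no_obstruction srt); exists a, b, c.
  by rewrite Et cats0.
have Ec : c = c'.
  by have := congr1 (last 0) Et; rewrite /= last_cat last_rcons.
have := le_st a c ain; rewrite (mem_subseq sub2) ?mem_rcons ?Ec ?inE ?eqxx //.
by move=> /(_ isT); lia.
Qed.

(** The word [rev st ++ input] is the part of the original input not yet output, in its original
    order. *)
Lemma sorted_tortoise_run (st input : seq nat) :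
  sorted ltn st ->
  sorted leq (tortoise_run st [::] input) <->
  ~ has_obstruction (rev st ++ input).
Proof.
elim: input st => [|x input IH] st srt /=.
  rewrite cats0; split=> _; first exact: decreasing_no_obstruction.
  by apply: sub_sorted srt => a b; exact: ltnW.
rewrite tortoise_stackE; case: ifP => [srtx|].
  (* A push moves [x] across the boundary and leaves this word unchanged. *)
  by rewrite IH // rev_cons cat_rcons.
(* An empty stack never refuses a push, so the stack has a top [h]. *)
case: st srt => // h st srt; rewrite /= in srt *; rewrite srt andbT => /negbT.
rewrite -leqNgt => lehx.
rewrite obstruction_at_break // -(IH [:: x]) // tortoise_run_cat.
have le_tr : transitive leq := leq_trans.
rewrite !sorted_pairwise // pairwise_cat.
(* The later output permutes [x :: input], and [allrel] ignores order. *)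
have -> : allrel leq (h :: st) (tortoise_run [:: x] [::] input) =
          allrel leq (h :: st) (x :: input).
  by apply: eq_all => s; apply: perm_all; exact: (perm_tortoise_run [:: x]).
have -> : pairwise leq (h :: st).
  rewrite -sorted_pairwise //; apply: (@sub_sorted _ ltn leq _ (h :: st)) srt.
  by move=> a b; exact: ltnW.
by split=> [/and3P[] | [-> ->]].
Qed.

Theorem theorem10 (w : seq nat) (hw : cayley w) :
  tortoise_sortable w <->
  [/\ avoids w [:: 2; 3; 1], avoids w [:: 3; 1; 2],
      avoids w [:: 2; 2; 1] & avoids w [:: 2; 1; 1]].
Proof. by rewrite avoids_obstruction; exact: (sorted_tortoise_run [::]). Qed.
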